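(* Let $(S,\to,\preceq)$ be a self-simulating transition system, $\phi$ a predicate on $S$ compatible with it, $(I,\trianglelefteq)$ a restricted reachability invariant of it with $I$ finite, and $f$ a restricted topological numbering for $(S,\to,\preceq)$, $\phi$ and $(I,\trianglelefteq)$. Then for every $s_0\in S$ for which there exists $t_0\in I$ with $s_0 \trianglelefteq t_0$, there is no Büchi run from $s_0$ in $\to$.
   Context: A transition system $(S,\to)$ is a set with a relation $\to\subseteq S\times S$. A self-simulating transition system (SSTS) $(S,\to,\preceq)$ is a transition system with a quasi-order (reflexive, transitive) $\preceq$ on $S$ such that for all $s,s',t$: if $s\preceq s'$ and $s\to t$ then there is $t'$ with $s'\to t'$ and $t\preceq t'$. A predicate $\phi$ on $S$ is compatible with the SSTS if $\phi(s)$ and $s\preceq s'$ imply $\phi(s')$. A Büchi run from $s_0$ is an infinite run $s_0\to s_1\to s_2\to\cdots$ with $\phi(s_i)$ for infinitely many $i$. A restricted reachability invariant is a pair $(I,\trianglelefteq)$ with $I\subseteq S$ and $\trianglelefteq$ a binary relation on $S$ such that (1) for all $s\in I$ and $t$ with $s\to t$ there exists $t'\in I$ with $t\trianglelefteq t'$, and (2) $s\trianglelefteq t$ implies $s\preceq t$. A restricted topological numbering (for the SSTS, $\phi$, and $(I,\trianglelefteq)$) is an integer-valued function $f$ on $I$ such that for all $s,t'\in I$ and $t\in S$ with $s\to t$ and $t\trianglelefteq t'$: $f(s)\ge f(t')$, and if moreover $\phi(s)$ then $f(s) > f(t')$. *)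

(* Defs.v *)
From Stdlib Require Export Relation_Definitions RelationClasses.
From mathcomp Require Export all_boot all_order all_algebra.
From mathcomp Require Export boolp classical_sets functions cardinality.

Set Implicit Arguments.
Unset Strict Implicit.
Unset Printing Implicit Defensive.

Local Open Scope classical_set_scope.
Local Open Scope ring_scope.

Record self_simulating (S : Type) (step le : relation S) : Prop := {
  ssts_quasi_order : PreOrder le;
  ssts_simulation : forall s s' t, le s s' -> step s t ->
    exists t', step s' t' /\ le t t'
}.

Definition compatible (S : Type) (le : relation S) (phi : S -> Prop) : Prop :=
  forall s s', phi s -> le s s' -> phi s'.

Definition buchi_run (S : Type) (step : relation S) (phi : S -> Prop)
    (s0 : S) (r : nat -> S) : Prop :=
  [/\ r 0%N = s0,
      forall i : nat, step (r i) (r i.+1)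
    & infinite_set [set i | phi (r i)]].

Record restricted_reachability_invariant (S : Type) (step le : relation S)
    (I : set S) (tri : relation S) : Prop := {
  rri_step : forall s t, I s -> step s t -> exists t', I t' /\ tri t t';
  rri_le : forall s t, tri s t -> le s t
}.

(* [I] used as a type is the subtype of the elements of the set [I], so [f] is
   defined on [I] only; [set_val] is the inclusion into [S]. *)
Definition restricted_topological_numbering (S : Type) (step : relation S)
    (phi : S -> Prop) (I : set S) (tri : relation S) (f : I -> int) : Prop :=
  forall (s t' : I) (t : S), step (set_val s) t -> tri t (set_val t') ->
    f t' <= f s /\ (phi (set_val s) -> f t' < f s).

(* Main.v *)
(** Along a run [r] from [s0], simulation and the invariant give for every [i]
    some [x] in [I] with [r i] below [x]; stepping forward never increases
    [f x], and decreases it when [phi (r i)], since then [phi x] by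
    compatibility. As [I] is finite, [f] has a least value over all the [x] in
    [I] that lie above some [r i]; past the index [i] where it is attained,
    [phi] never holds again. *)
Require Import Defs.

Set Implicit Arguments.
Unset Strict Implicit.
Unset Printing Implicit Defensive.

Import Order.TTheory.

Local Open Scope classical_set_scope.

Lemma finite_set_min (d : Order.disp_t) (T : orderType d) (A : set T) :
  finite_set A -> A !=set0 -> exists2 a, A a & forall b, A b -> (a <= b)%O.
Proof.
move=> /finite_seqP[s ->] [a0 /= a0s].
(* The induction runs over the tail with the head [x] general, so that the list stays nonempty. *)
case: s a0s => // x s _; elim: s x => [|y s IH] x.
  by exists x => [|b]; rewrite /= ?inE // => /eqP ->.
have [a /= a_ys min_a] := IH y.
have [xa | /ltW ax] := leP x a.
- exists x => [|b] /=; first exact: mem_head.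
  by rewrite inE => /predU1P[-> // | /min_a]; apply: le_trans.
- exists a => [|b] /=; first by rewrite inE a_ys orbT.
  by rewrite inE => /predU1P[-> // | /min_a].
Qed.

Lemma finite_set_argmin (X : Type) (d : Order.disp_t) (T : orderType d)
    (f : X -> T) (W : set X) :
  finite_set W -> W !=set0 ->
  exists2 x, W x & forall y, W y -> (f x <= f y)%O.
Proof.
move=> Wfin [w Ww].
have fW0 : f @` W !=set0 by exists (f w), w.
have [_ [x Wx <-] min_x] := finite_set_min (finite_image f Wfin) fW0.
by exists x => // y Wy; apply: min_x; exists y.
Qed.

(** The inclusion [set_val] is injective, so the preimage of [A] under it is finite, and this
    preimage contains [B]. *)
Lemma finite_set_type (X : Type) (A : set X) (B : set A) :
  finite_set A -> finite_set B.
Proof.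
move=> Afin; apply: (@sub_finite_set _ _ (set_val @^-1` A)) => [x _|].
  exact: set_valP.
by apply: finite_preimage => // x y _ _; apply: val_inj.
Qed.

Section Runs.

Variables (S : Type) (step le : relation S) (phi : S -> Prop).
Variables (I : set S) (tri : relation S) (f : I -> int).
Hypothesis hS : self_simulating step le.
Hypothesis hphi : compatible le phi.
Hypothesis hI : restricted_reachability_invariant step le I tri.
Hypothesis hf : restricted_topological_numbering step phi tri f.

(** Simulation lifts the step to one from [x] to some [u] above [t], possibly outside [I]; the
    invariant then provides [y] in [I] above [u], and the numbering compares [x] with [y]. *)
Lemma invariant_above_step (s t : S) (x : I) :
  step s t -> le s (set_val x) ->
  exists y : I, [/\ le t (set_val y), (f y <= f x)%R & phi s -> (f y < f x)%R].
Proof.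
move=> st sx.
have [u [xu tu]] := ssts_simulation hS sx st.
have [u' [Iu' uu']] := rri_step hI (set_valP x) xu.
have [le_f lt_f] := hf (t' := SigSub (mem_set Iu')) xu uu'.
exists (SigSub (mem_set Iu')); split=> // [|phis].
  have [_ le_trans] := ssts_quasi_order hS.
  exact: le_trans tu (rri_le hI uu').
exact: lt_f (hphi phis sx).
Qed.

Lemma invariant_above_run (r : nat -> S) (i : nat) (x : I) :
  (forall k : nat, step (r k) (r k.+1)) -> le (r i) (set_val x) ->
  forall k : nat, i <= k ->
  exists y : I, le (r k) (set_val y) /\ (f y <= f x)%R.
Proof.
move=> r_step ix k /subnK <-; elim: (k - i) => [|n [y [ny yx]]].
  by exists x.
have [z [nz zy _]] := invariant_above_step (r_step _) ny.
by exists z; split=> //; apply: le_trans zy yx.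
Qed.

End Runs.

Theorem theorem3 (S : Type) (step le : relation S) (phi : S -> Prop)
    (I : set S) (tri : relation S) (f : I -> int)
    (hS : self_simulating step le)
    (hphi : compatible le phi)
    (hI : restricted_reachability_invariant step le I tri)
    (hfin : finite_set I)
    (hf : restricted_topological_numbering step phi tri f) :
  forall s0 : S, (exists t0 : S, I t0 /\ tri s0 t0) ->
    ~ exists r : nat -> S, buchi_run step phi s0 r.
Proof.
move=> s0 [t0 [It0 s0t0]] [r [r0 r_step r_inf]].
pose W : set I := [set x | exists i, le (r i) (set_val x)].
have W0 : W !=set0.
  by exists (SigSub (mem_set It0)), 0; rewrite r0; apply: rri_le hI _ _ s0t0.
have [x [i ix] min_x] := finite_set_argmin f (finite_set_type W hfin) W0.
(* It is enough that every [k] with [phi (r k)] is below [i]. *)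
apply: r_inf; apply: (sub_finite_set _ (finite_II i)) => k /= phik.
rewrite ltnNge; apply/negP => ik.
(* If [i <= k], the strict descent at [k] yields [z] in [W] with [f z < f x], against the minimality
   of [f x]. *)
have [y [ky yx]] := invariant_above_run hS hphi hI hf r_step ix ik.
have [z [kz _ /(_ phik) zy]] := invariant_above_step hS hphi hI hf (r_step k) ky.
have /min_x : W z by exists k.+1.
by rewrite leNgt (lt_le_trans zy yx).
Qed.
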